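(* Let $\delta\in(0,1)$, and for $w\in A^*$ with $\min_{1\le\ell\le L}N_{n-1,\ell}(w)>0$ and $\ell=1,\dots,L$ let $\mathrm{conf}^I_\ell(w)=c_\ell\big(w,\frac{\delta}{n^2|\mathcal S|L}\big)$. If the confidence radius is set to $\mathrm{conf}_\ell(w)=\min\{\mathrm{conf}^I_\ell(w),1\}$, then with probability at least $1-\delta$ the event $\mathrm{Good}_\infty$ occurs.
   Context: $A$ is a finite alphabet; $A^{-1}_{-\infty}$ is the set of left-infinite sequences $x=\cdots x_{-2}x_{-1}$ over $A$, and $A^*$ the set of finite strings (including the empty string) and left-infinite sequences. For $\ell=1,\dots,L$, $X(\ell)=(X_t(\ell))_{t\in\mathbb Z}$ is a stationary ergodic $A$-valued process with transition probabilities $p_\ell(a\mid x)=\Pr(X_0(\ell)=a\mid X^{-1}_{-\infty}(\ell)=x)$; one observes $X_1^n(\ell)$ for each $\ell$. For a finite string $w$, $N_{j,\ell}(w)$ is the number of occurrences of $w$ as a block of consecutive symbols in $X_1^j(\ell)$ (0 for infinite $w$); $wa$ is concatenation. For $w$ with $\min_\ell N_{n-1,\ell}(w)>0$ and $S\subseteq A$: $\hat p_{n,\ell}(S\mid w)=\sum_{a\in S}N_{n,\ell}(wa)/N_{n-1,\ell}(w)$ and $\bar p_{n,\ell}(S\mid w)=\frac{1}{N_{n-1,\ell}(w)}\sum_{i=|w|+1}^{n}\mathbf 1\{X^{i-1}_{i-|w|}(\ell)=w\}p_\ell(S\mid X^{i-1}_{-\infty}(\ell))$. The family $\mathcal S$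 is either $\{\{a\}:a\in A\}$ or $2^A$, and every $d_\ell$ is $d_\ell(q,q')=\max_{S\in\mathcal S}|q(S)-q'(S)|$. For $w$ with $N_{n-1,\ell}(w)>0$ and $\epsilon\in(0,1)$, $c_\ell(w,\epsilon)=2\sqrt{\frac{1}{N_{n-1,\ell}(w)}}\sqrt{\log(1/\epsilon)+2\log(2+2\log N_{n-1,\ell}(w))}$. For $v\in\mathbb R^L$, $\|v\|_{L,\infty}=\max_\ell|v_\ell|$. The event $\mathrm{Good}_\infty$: for every $w\in A^*$ with $\min_\ell N_{n-1,\ell}(w)>0$, $\max_{\ell}d_\ell(\bar p_{n,\ell}(\cdot\mid w),\hat p_{n,\ell}(\cdot\mid w))/\mathrm{conf}_\ell(w)\le1$. *)

(* Defs.v *)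
From HB Require Import structures.
From mathcomp Require Import all_boot all_order all_algebra.
From mathcomp Require Import all_classical all_reals all_analysis.
Set Implicit Arguments. Unset Strict Implicit. Unset Printing Implicit Defensive.
Import Order.TTheory GRing.Theory Num.Theory.
Local Open Scope classical_set_scope.
Local Open Scope ring_scope.

Section Defs.
Variable A : finType.

(* Cylinder sigma-algebra on left-infinite sequences x = ... x_{-2} x_{-1},
   encoded as x : nat -> A with x k = x_{-(k+1)}. *)
Definition cylN : set (set (nat -> A)) :=
  fun B => exists (k : nat) (a : A), B = [set x | x k = a].
Definition past_measurable (B : set (nat -> A)) : Prop := <<s cylN >> B.

Definition cylZ : set (set (int -> A)) :=
  fun B => exists (t : int) (a : A), B = [set x | x t = a].
Definition path_measurable (B : set (int -> A)) : Prop := <<s cylZ >> B.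
Definition shiftZ (x : int -> A) : int -> A := fun t => x (t + 1).

Variables (d : measure_display) (Omega : measurableType d) (R : realType).

Definition block (X : int -> Omega -> A) (t : int) (k : nat) (om : Omega) : seq A :=
  [seq X (t + (j%:Z)) om | j <- iota 0 k].

Definition is_stationary (P : probability Omega R) (X : int -> Omega -> A) : Prop :=
  forall (w : seq A) (t s : int),
    P [set om | block X t (size w) om = w] = P [set om | block X s (size w) om = w].

Definition path_of (X : int -> Omega -> A) (om : Omega) : int -> A := fun t => X t om.

Definition is_ergodic (P : probability Omega R) (X : int -> Omega -> A) : Prop :=
  forall B : set (int -> A), path_measurable B -> shiftZ @^-1` B = B ->
    P (path_of X @^-1` B) = 0%E \/ P (path_of X @^-1` B) = 1%E.

Definition past (X : int -> Omega -> A) (t : int) (om : Omega) : nat -> A :=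
  fun k => X (t - 1 - k%:Z) om.

(* p(. | x) is the transition probability of X:
   a probability vector, measurable in x, and a version of
   Pr(X_0 = a | X^{-1}_{-infinity} = x). *)
Definition is_transition_prob (P : probability Omega R) (X : int -> Omega -> A)
    (p : (nat -> A) -> A -> R) : Prop :=
  [/\ (forall x a, 0 <= p x a),
      (forall x, \sum_(a : A) p x a = 1),
      (forall a (U : set R), measurable U ->
          past_measurable ((fun x => p x a) @^-1` U)) &
      (forall a (B : set (nat -> A)), past_measurable B ->
          (\int[P]_(om in past X 0%R @^-1` B) (p (past X 0%R om) a)%:E
            = P (past X 0%R @^-1` B `&` [set om | X 0%R om = a]))%E)].

Definition occurs_at (X : int -> Omega -> A) (w : seq A) (i : nat) (om : Omega) : bool :=
  (size w <= i)%N && (block X (i%:Z - (size w)%:Z + 1) (size w) om == w).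

(* N_j(w): number of occurrences of w in X_1^j; the empty string occurs
   at the j+1 positions 0..j *)
Definition Ncount (X : int -> Omega -> A) (j : nat) (w : seq A) (om : Omega) : nat :=
  \sum_(0 <= i < j.+1 | occurs_at X w i om) 1.

Definition p_hat (X : int -> Omega -> A) (n : nat) (S : {set A}) (w : seq A)
    (om : Omega) : R :=
  (\sum_(a in S) (Ncount X n (rcons w a) om)%:R) / (Ncount X n.-1 w om)%:R.

Definition p_bar (X : int -> Omega -> A) (p : (nat -> A) -> A -> R) (n : nat)
    (S : {set A}) (w : seq A) (om : Omega) : R :=
  (Ncount X n.-1 w om)%:R^-1 *
  \sum_((size w).+1 <= i < n.+1 | occurs_at X w i.-1 om)
     \sum_(a in S) p (past X i%:Z om) a.

Definition dist_fam (fam : {set {set A}}) (q q' : {set A} -> R) : R :=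
  \big[Num.max/0]_(S in fam) `|q S - q' S|.

Definition conf_c (N : nat) (eps : R) : R :=
  2 * Num.sqrt (N%:R^-1) * Num.sqrt (ln (eps^-1) + 2 * ln (2 + 2 * ln N%:R)).

End Defs.

(* Main.v *)
Require Import Defs.
From HB Require Import structures.
From mathcomp Require Import all_boot all_order all_algebra.
From mathcomp Require Import all_classical all_reals all_analysis.
From mathcomp Require Import measurable_realfun.
From mathcomp Require Import zify ring lra.
Set Implicit Arguments. Unset Strict Implicit. Unset Printing Implicit Defensive.
Import Order.TTheory GRing.Theory Num.Theory.
Local Open Scope classical_set_scope.
Local Open Scope ring_scope.

(* A word w that occurs in X_1^{n-1} is determined by its length m
   and by the position j at which its first occurrence ends, which leaves n^2
   pairs (j, m) that do not depend on the sample. Once X_1^j is known, so is w,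
   hence the sum M of p(S | past) - 1{X_t in S} over the times t at which w has
   just been read is a martingale with bounded increments, and with N the number
   of occurrences, E exp(lam M - lam^2 N / 2) <= 1 for |lam| <= 1. Mixing these
   exponentials over lam = +- lam_k, with lam_k tuned to 4^k <= N < 4^(k+1) and
   weights 1/(2+2k)^2 of total mass at most 1/2, gives a variable of mean at most
   1 that is at least 1/eps as soon as |M| / N exceeds conf_c(N, eps) < 1. Markov's
   inequality and a union bound over l, S and (j, m) conclude. *)

(** * Conditional expectations given a measurable map *)

Section conditional_expectation.
Local Open Scope ereal_scope.
Context d d' (X : measurableType d) (Y : measurableType d') (R : realType).
Variables (mu : {measure set X -> \bar R}) (phi : X -> Y).
Hypothesis mphi : measurable_fun setT phi.
Import HBNNSimple.

(** Splitting over the finitely many values of [h] leaves integrals of [f] over preimages under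
    [phi], which are what a conditional expectation given [phi] controls. *)
Lemma integral_nnsfun_comp_mul (h : {nnsfun Y >-> R}) (f : X -> R) :
  measurable_fun [set: X] f -> (forall x, (0 <= f x)%R) ->
  \int[mu]_x ((h (phi x))%:E * (f x)%:E) =
  \sum_(r \in range h)
    (r%:E * \int[mu]_(x in phi @^-1` (h @^-1` [set r])) (f x)%:E).
Proof.
move=> mf f0.
have mpre r : measurable (phi @^-1` (h @^-1` [set r])).
  by rewrite -[X in measurable X]setTI; apply: mphi.
pose fr (r : R) : X -> \bar R := (EFin \o f) \_ (phi @^-1` (h @^-1` [set r])).
have mfr r : measurable_fun [set: X] (fr r).
  by apply/(measurable_restrictT _ (mpre r))/measurable_funTS/measurable_EFinP.
have fr0 r x : 0 <= fr r x.
  by rewrite /fr patchE; case: ifPn => //= _; rewrite lee_fin.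
transitivity (\int[mu]_x (\sum_(r \in range h) (r%:E * fr r x))).
  apply: eq_integral => x _; rewrite fimfunE -fsumEFin// ge0_mule_fsuml; last first.
    by move=> r; exact: nnfun_muleindic_ge0.
  apply: eq_fsbigr => r _; rewrite EFinM -muleA; congr (_ * _).
  rewrite /fr patchE indicE.
  have -> : (phi x \in h @^-1` [set r]) = (x \in phi @^-1` (h @^-1` [set r])).
    by apply/idP/idP; rewrite !inE.
  by case: (x \in _); rewrite ?mul1e ?mul0e.
rewrite ge0_integral_fsum//; last 2 first.
- by move=> r; exact: measurable_funeM.
- move=> r x _; case: (ltP r 0%R) => r0; last by rewrite mule_ge0.
  rewrite /fr patchE; case: ifPn; last by rewrite mule0.
  by rewrite inE => /= hr; move: r0; rewrite -hr ltNge fun_ge0.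
apply: eq_fsbigr => r; rewrite inE => -[y _ hyr].
rewrite ge0_integralZl//; last by rewrite -hyr lee_fin.
by rewrite /fr -integral_mkcond.
Qed.

(** The integral hypothesis says that [f] and [g] have the same conditional expectation given [phi];
    simple functions and monotone convergence carry it to [G]. *)
Lemma eq_integral_comp_mul (f g : X -> R) (G : Y -> \bar R) :
  measurable_fun [set: X] f -> (forall x, (0 <= f x)%R) ->
  measurable_fun [set: X] g -> (forall x, (0 <= g x)%R) ->
  (forall B, measurable B -> \int[mu]_(x in phi @^-1` B) (f x)%:E =
                             \int[mu]_(x in phi @^-1` B) (g x)%:E) ->
  measurable_fun [set: Y] G -> (forall y, 0 <= G y) ->
  \int[mu]_x (G (phi x) * (f x)%:E) = \int[mu]_x (G (phi x) * (g x)%:E).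
Proof.
move=> mf f0 mg g0 fg mG G0.
pose h := nnsfun_approx measurableT mG.
have approx (k : X -> R) : measurable_fun [set: X] k ->
    (forall x, (0 <= k x)%R) -> \int[mu]_x (G (phi x) * (k x)%:E) =
    limn (fun n => \int[mu]_x ((h n (phi x))%:E * (k x)%:E)).
  move=> mk k0.
  have -> : \int[mu]_x (G (phi x) * (k x)%:E) =
      \int[mu]_x limn (fun n => ((h n (phi x))%:E * (k x)%:E)).
    apply: eq_integral => x _; apply/esym/cvg_lim => //.
    apply: cvgeZr => //.
    exact: (@cvg_nnsfun_approx _ _ _ _ measurableT _ mG).
  apply: monotone_convergence => //.
  - move=> n; apply: emeasurable_funM; apply/measurable_EFinP => //.
    exact: measurableT_comp.
  - by move=> n x _; rewrite mule_ge0// lee_fin.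
  - move=> x _ m n mn; rewrite lee_wpmul2r ?lee_fin//.
    exact/lefP/nd_nnsfun_approx.
rewrite !approx//; congr (limn _); apply/funext => n.
rewrite !integral_nnsfun_comp_mul//; apply: eq_fsbigr => r _.
by rewrite fg// -[X in measurable X]setTI; exact: measurable_funP.
Qed.

End conditional_expectation.

(** * Stationary processes and their pasts *)

(* The product sigma-algebra of Defs on left-infinite pasts as a measurable
   type; measurable types are pointed, hence the letter a0. *)
Definition past_space (A : finType) (a0 : A) : Type := nat -> A.

Section past_space.
Variables (A : finType) (a0 : A).
HB.instance Definition _ := gen_eqMixin (past_space a0).
HB.instance Definition _ := gen_choiceMixin (past_space a0).
HB.instance Definition _ := isPointed.Build (past_space a0) (fun=> a0).
HB.instance Definition _ := @isMeasurable.Build (sigma_display (@cylN A))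
  (past_space a0) (@past_measurable A) (@sigma_algebra0 _ setT _)
  (fun B (mB : past_measurable B) =>
    eq_ind _ (@past_measurable A) (sigma_algebraCD mB) _ (setTD B))
  (@sigma_algebra_bigcup _ setT _).

(** Coordinate 0 is the most recent symbol, so this shift turns the past of [t + 1] into the past of
    [t]. *)
Definition drop_last (x : past_space a0) : past_space a0 := fun k => x k.+1.

Lemma measurable_coord k (a : A) :
  measurable [set x : past_space a0 | x k = a].
Proof. by apply: sub_sigma_algebra; exists k, a. Qed.

Lemma measurable_fun_past_space d (T : measurableType d) (f : T -> past_space a0) :
  (forall k a, measurable (f @^-1` [set x | x k = a])) ->
  measurable_fun [set: T] f.
Proof.
move=> mf; apply: (@measurability _ _ T (past_space a0) setT f (@cylN A)) => //.
by move=> _ [_ [k [a ->]] <-]; rewrite setTI; exact: mf.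
Qed.

Lemma measurable_drop_last : measurable_fun [set: past_space a0] drop_last.
Proof.
by apply: measurable_fun_past_space => k a; exact: measurable_coord.
Qed.

Definition cylinder (w : seq A) : set (past_space a0) :=
  [set x | mkseq x (size w) = w].

Lemma measurable_cylinder w : measurable (cylinder w).
Proof.
have -> : cylinder w =
    \bigcap_(i < size w) [set x : past_space a0 | x i = nth a0 w i].
  apply/seteqP; split=> x /= xw.
    by move=> i /= iw; rewrite -[in RHS]xw nth_mkseq.
  apply: (@eq_from_nth _ a0); rewrite size_mkseq// => i iw.
  by rewrite nth_mkseq//; exact: xw.
by apply: bigcap_measurableType => i _; exact: measurable_coord.
Qed.

Definition cylinders : set (set (past_space a0)) :=
  [set B | B = set0 \/ exists w, B = cylinder w].

(** Two cylinders are nested when the shorter word is a prefix of the longer, and disjoint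
    otherwise; the second case is why [cylinders] contains [set0]. *)
Lemma setI_closed_cylinders : setI_closed cylinders.
Proof.
have sub w v : (size w <= size v)%N -> cylinders (cylinder w `&` cylinder v).
  move=> wv; have [vw|vw] := eqVneq (take (size w) v) w.
    right; exists v; rewrite setIC; apply/setIidPl => x /= xv.
    by rewrite /cylinder/= -[RHS]vw -xv -!map_take take_iota (minn_idPl wv).
  left; apply/seteqP; split => // x [/= xw xv]; move/eqP: vw; apply.
  by rewrite -[RHS]xw -xv -!map_take take_iota (minn_idPl wv).
move=> _ _ [->|[w ->]] [->|[v ->]]; rewrite ?set0I ?setI0; try by left.
have [/sub//|/ltnW/sub] := leqP (size w) (size v).
by rewrite setIC.
Qed.

Lemma cylinders_generate :
  @measurable _ (past_space a0) = <<s cylinders >>.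
Proof.
apply/seteqP; split.
  apply: smallest_sub; first exact: smallest_sigma_algebra.
  move=> _ [k [a ->]].
  have -> : [set x : nat -> A | x k = a] =
      \bigcup_(w in [set w : k.+1.-tuple A | tnth w ord_max = a]) cylinder w.
    apply/seteqP; split => x /=.
      move=> xka; exists [tuple of mkseq x k.+1]; last first.
        by rewrite /cylinder/= size_map size_iota.
      by rewrite /= (tnth_nth a0) nth_mkseq.
    move=> [w /= wk]; rewrite /cylinder/= size_tuple => xw.
    by rewrite -wk (tnth_nth a0) -xw nth_mkseq.
  apply: (@fin_bigcup_measurable _ (g_sigma_algebraType cylinders)) => //.
  move=> w _; apply: sub_sigma_algebra; right; by exists w.
apply: smallest_sub; first exact: sigma_algebra_measurable.
move=> _ [->|[w ->]]; first exact: measurable0.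
exact: measurable_cylinder.
Qed.

End past_space.


Section stationary_process.
Local Open Scope ereal_scope.
Context (A : finType) d (Omega : measurableType d) (R : realType).
Variables (P : probability Omega R) (X : int -> Omega -> A) (a0 : A).
Hypothesis mX : forall t a, measurable (X t @^-1` [set a]).

Lemma measurable_past t :
  measurable_fun [set: Omega] (past X t : Omega -> past_space a0).
Proof. by apply: measurable_fun_past_space => k a; exact: mX. Qed.

Definition past_rv t : {mfun Omega >-> past_space a0} :=
  HB.pack (past X t : Omega -> past_space a0)
    (isMeasurableFun.Build _ _ _ _ _ (measurable_past t)).

Lemma drop_last_past t om : drop_last (past X (t + 1) om : past_space a0) = past X t om.
Proof. by apply/funext => k; rewrite /drop_last /past; congr (X _ om); lia. Qed.

Lemma past_coord0 t om : past X (t + 1) om 0%N = X t om.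
Proof. by rewrite /past; congr (X _ om); lia. Qed.

Lemma mkseq_past t om m : mkseq (past X t om) m = rev (block X (t - m%:Z) m om).
Proof.
apply: (@eq_from_nth _ a0); rewrite ?size_rev ?size_map ?size_iota// => i im.
rewrite nth_mkseq// nth_rev ?size_map ?size_iota//.
rewrite (nth_map 0%N) ?size_iota; last by lia.
by rewrite nth_iota; [rewrite /past; congr (X _ om); lia|lia].
Qed.

Hypothesis stX : is_stationary P X.

(** Stationarity of blocks gives equal laws on cylinders, a generating pi-system, and uniqueness of
    finite measures extends this. Words are reversed because pasts run backwards in time. *)
Lemma stationary_past s t (B : set (past_space a0)) : measurable B ->
  P (past X s @^-1` B) = P (past X t @^-1` B).
Proof.
move=> mB.
rewrite -[LHS]/(distribution P (past_rv s) B) -[RHS]/(distribution P (past_rv t) B).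
apply: (measure_unique (@cylinders A a0) (fun=> setT)) => //.
- exact: cylinders_generate.
- exact: setI_closed_cylinders.
- by move=> _; right; exists [::]; apply/seteqP; split.
- by rewrite bigcup_const//; exists 0%N.
- move=> _ [->|[w ->]]; first by rewrite !measure0.
  have E u : past X u @^-1` @cylinder A a0 w =
      [set om | block X (u - (size w)%:Z)%R (size (rev w)) om = rev w].
    apply/seteqP; split => om; rewrite /cylinder/= mkseq_past size_rev.
      by move=> <-; rewrite revK size_rev size_map size_iota.
    by move=> ->; rewrite revK.
  transitivity (P (past X s @^-1` @cylinder A a0 w)); first by [].
  by rewrite E (stX _ _ (t - (size w)%:Z)%R) -E.
- by move=> _; exact: (@fin_num_fun_lty _ _ _ (distribution P (past_rv s))).
Qed.

Lemma stationary_integral s t (F : past_space a0 -> \bar R) :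
  measurable_fun [set: past_space a0] F -> (forall x, 0 <= F x) ->
  \int[P]_om F (past X s om) = \int[P]_om F (past X t om).
Proof.
move=> mF F0.
have E u : \int[P]_om F (past X u om) = \int[distribution P (past_rv u)]_x F x.
  by rewrite ge0_integral_distribution.
rewrite !E; apply: eq_measure_integral => B mB _.
exact: stationary_past.
Qed.

End stationary_process.

(** * The exponential supermartingale *)

Section hoeffding.
Variable R : realType.

(** From [1 - x/2 <= exp (-x/2)] follows [exp x <= (1 - x/2)^-2]; the polynomial inequality that
    remains has a difference that factors with visible signs for [x <= 1]. *)
Lemma expR_le_quadratic (x : R) : x <= 1 -> expR x <= 1 + x + 2 * x ^+ 2.
Proof.
move=> x1; have x2 : 0 < 1 - x / 2 by lra.
have e2 : 1 - x / 2 <= expR (- (x / 2)) by rewrite expR_ge1Dx.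
have ex : expR x * expR (- (x / 2)) ^+ 2 = 1.
  rewrite -expRM_natl -expRD (_ : x + _ = 0) ?expR0//.
  by field.
have : expR x * (1 - x / 2) ^+ 2 <= 1.
  by rewrite -[leRHS]ex ler_pM2l ?expR_gt0// lerXn2r// ?nnegrE ?expR_ge0// ltW.
have : 1 <= (1 + x + 2 * x ^+ 2) * (1 - x / 2) ^+ 2.
  rewrite -subr_ge0 [X in 0 <= X](_ : _ =
    x ^+ 2 * ((1 - x) * (5 / 2 - x) / 2)); last by field.
  by rewrite mulr_ge0 ?sqr_ge0// divr_ge0// mulr_ge0; lra.
move=> h1 h2; rewrite -(ler_pM2r (exprn_gt0 2 x2)).
exact: le_trans h1.
Qed.

(* The variance bound q (1 - q) <= 1/4 absorbs the factor 2 of the quadratic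
   estimate. *)
Lemma bernoulli_exp_moment (q lam : R) : 0 <= q <= 1 -> `|lam| <= 1 ->
  q * expR (lam * (q - 1) - lam ^+ 2 / 2) +
    (1 - q) * expR (lam * q - lam ^+ 2 / 2) <= 1.
Proof.
move=> /andP[q0 q1]; rewrite ler_norml => /andP[l1 l2].
rewrite !expRD !expRN !mulrA -mulrDl ler_pdivrMr ?expR_gt0// mul1r.
have h1 : expR (lam * (q - 1)) <= 1 + lam * (q - 1) + 2 * (lam * (q - 1)) ^+ 2.
  by apply: expR_le_quadratic; nra.
have h2 : expR (lam * q) <= 1 + lam * q + 2 * (lam * q) ^+ 2.
  by apply: expR_le_quadratic; nra.
apply: le_trans (expR_ge1Dx _).
apply: (@le_trans _ _ (1 + 2 * lam ^+ 2 * (q * (1 - q)))).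
  have a1 := ler_wpM2l q0 h1.
  have q1' : 0 <= 1 - q by lra.
  have a2 := ler_wpM2l q1' h2.
  lra.
have : 0 <= lam ^+ 2 by rewrite sqr_ge0.
have : 0 <= (q - 1 / 2) ^+ 2 by rewrite sqr_ge0.
nra.
Qed.

End hoeffding.

(** * One-step conditioning at an arbitrary time *)

Section transition.
Local Open Scope ereal_scope.
Context (A : finType) d (Omega : measurableType d) (R : realType).
Variables (P : probability Omega R) (X : int -> Omega -> A) (a0 : A).
Variable p : (nat -> A) -> A -> R.
Hypothesis mX : forall t a, measurable (X t @^-1` [set a]).
Hypothesis stX : is_stationary P X.
Hypothesis trX : is_transition_prob P X p.
Local Notation T := (@past_space A a0).

Lemma measurable_transition a : measurable_fun [set: T] (p^~ a : T -> R).
Proof.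
have [_ _ mp _] := trX.
by move=> _ U mU; rewrite setTI; exact: mp.
Qed.

Lemma integral_transition (G : T -> \bar R) a :
  measurable_fun [set: T] G -> (forall x, 0 <= G x) ->
  \int[P]_om (G (past X 0%R om) * (\1_(X 0%R @^-1` [set a]) om)%:E) =
  \int[P]_om (G (past X 0%R om) * (p (past X 0%R om) a)%:E).
Proof.
have [p0 _ _ condp] := trX => mG G0.
apply: (@eq_integral_comp_mul _ _ _ _ _ _ (past X 0%R : Omega -> T)) => //.
- exact: measurable_past.
- apply: (measurableT_comp (measurable_transition a)).
  exact: measurable_past.
- move=> B mB; rewrite condp// integral_indic//.
  + by rewrite setIC.
  + by rewrite -[X in measurable X]setTI; exact: (measurable_past mX _ measurableT mB).
Qed.

(* Stationarity moves the identity from time 0, where p is a version of the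
   conditional probability, to time t. *)
Lemma integral_one_step t (F : A -> T -> R) :
  (forall a, measurable_fun [set: T] (F a)) -> (forall a x, (0 <= F a x)%R) ->
  \int[P]_om (F (X t om) (past X t om))%:E =
  \int[P]_om (\sum_a p (past X t om) a * F a (past X t om))%:E.
Proof.
have [p0 _ _ _] := trX => mF F0.
(* The symbol at time [t] is coordinate 0 of the past of [t + 1], so the left integrand is a
   function of a single past, to which stationarity applies. *)
pose W (x : T) := (F (x 0%N) (drop_last x))%:E.
have WE (x : T) : W x = \sum_a (F a (drop_last x) * \1_[set x : T | x 0%N = a] x)%:E.
  rewrite (bigD1 (x 0%N))//= big1 ?adde0 => [|a ax].
    by rewrite indicE mem_set// mulr1.
  by rewrite indicE memNset ?mulr0//= => /esym/eqP; exact/negP.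
have mW : measurable_fun [set: T] W.
  rewrite (funext WE); apply: emeasurable_sum => a.
  apply/measurable_EFinP/measurable_funM.
    exact: measurableT_comp (@measurable_drop_last A a0).
  by apply: measurable_indic; exact: measurable_coord.
have W0 x : 0 <= W x by rewrite lee_fin.
transitivity (\int[P]_om W (past X (t + 1)%R om)).
  by apply: eq_integral => om _; rewrite /W drop_last_past past_coord0.
rewrite (stationary_integral (a0 := a0) mX stX _ (0 + 1)%R)//.
transitivity (\int[P]_om (\sum_a ((F a (past X 0%R om))%:E *
     (\1_(X 0%R @^-1` [set a]) om)%:E))).
  apply: eq_integral => om _; rewrite WE; apply: eq_bigr => a _.
  by rewrite drop_last_past EFinM.
have mFp u a : measurable_fun [set: Omega] (fun om => F a (past X u om)).
  exact: (measurableT_comp (mF a) (@measurable_past _ _ _ X a0 mX u)).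
rewrite ge0_integral_sum//; last 2 first.
- move=> a; apply: emeasurable_funM; exact/measurable_EFinP.
- by move=> a om _; rewrite mule_ge0// lee_fin.
have mEF a : measurable_fun [set: T] (EFin \o F a) by exact/measurable_EFinP.
have EF0 a x : 0 <= (EFin \o F a) x by rewrite lee_fin.
under eq_bigr => a _ do rewrite (integral_transition a (mEF a) (EF0 a)).
rewrite -ge0_integral_sum//; last 2 first.
- move=> a; apply: emeasurable_funM; apply/measurable_EFinP => //.
  apply: (measurableT_comp (measurable_transition a)).
  exact: measurable_past.
- by move=> a om _; rewrite mule_ge0// lee_fin.
pose V (x : T) := (\sum_a p x a * F a x)%:E.
rewrite -[RHS]/(\int[P]_om V (past X t om)).
rewrite (stationary_integral (a0 := a0) mX stX _ 0%R)//.
- apply: eq_integral => om _; rewrite /V -sumEFin; apply: eq_bigr => a _.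
  by rewrite /= muleC -EFinM.
- apply/measurable_EFinP/measurable_sum => a; apply: measurable_funM => //.
  exact: measurable_transition.
- by move=> x; rewrite lee_fin sumr_ge0// => a _; rewrite mulr_ge0.
Qed.

End transition.

Section exponential_supermartingale.
Context (A : finType) d (Omega : measurableType d) (R : realType).
Variables (P : probability Omega R) (X : int -> Omega -> A) (a0 : A).
Variable p : (nat -> A) -> A -> R.
Hypothesis mX : forall t a, measurable (X t @^-1` [set a]).
Hypothesis stX : is_stationary P X.
Hypothesis trX : is_transition_prob P X p.
Local Notation T := (@past_space A a0).
(** The selection [e t] depends on the past of [t] only, hence is predictable; it will mark the
    times at which a word has just been read. *)
Variables (e : nat -> T -> bool) (S : {set A}) (lam : R).
Hypothesis me : forall t, measurable_fun [set: T] (e t).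

Definition trans_set (x : nat -> A) : R := \sum_(a in S) p x a.

Lemma trans_set_itv x : 0 <= trans_set x <= 1.
Proof.
have [p0 p1 _ _] := trX.
rewrite sumr_ge0//= -(p1 x) [leRHS](bigID (mem S))/= lerDl.
by rewrite sumr_ge0.
Qed.

Lemma measurable_trans_set : measurable_fun [set: T] (trans_set : T -> R).
Proof.
have -> : trans_set = fun x : T => \sum_a if a \in S then p x a else 0.
  by apply/funext => x; rewrite /trans_set big_mkcond.
apply: measurable_sum => a; case: (a \in S) => //.
exact: measurable_transition trX a.
Qed.

Definition tilt_step t (a : A) (x : T) : R :=
  if e t x then expR (lam * (trans_set x - (a \in S)%:R) - lam ^+ 2 / 2) else 1.

(* The value at time t of exp (lam M - lam^2 N / 2), as a function of the past
   of t; see tiltE. *)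
Fixpoint tilt t (x : T) : R :=
  if t is t'.+1 then tilt t' (drop_last x) * tilt_step t' (x 0%N) (drop_last x)
  else 1.

Lemma tilt_step_ge0 t a x : 0 <= tilt_step t a x.
Proof. by rewrite /tilt_step; case: ifP => // _; exact: expR_ge0. Qed.

Lemma tilt_ge0 t x : 0 <= tilt t x.
Proof. by elim: t x => //= t IH x; rewrite mulr_ge0// tilt_step_ge0. Qed.

Lemma measurable_tilt_step t a : measurable_fun [set: T] (tilt_step t a).
Proof.
apply: measurable_fun_ifT => //.
apply: measurableT_comp; first exact: measurable_expR.
apply: measurable_funB => //; apply: measurable_funM => //.
by apply: measurable_funB => //; exact: measurable_trans_set.
Qed.

Lemma measurable_tilt t : measurable_fun [set: T] (tilt t).
Proof.
elim: t => [|t IH] /=; first exact: measurable_cst.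
(* The latest symbol has finitely many values; summing over them separates it from the older
   past. *)
have -> : (fun x => tilt t (drop_last x) * tilt_step t (x 0%N) (drop_last x)) =
    (fun x => \sum_a tilt t (drop_last x) *
      (tilt_step t a (drop_last x) * \1_[set x : T | x 0%N = a] x)).
  apply/funext => x; rewrite (bigD1 (x 0%N))//= big1 ?addr0 => [|a ax].
    by rewrite indicE mem_set// mulr1.
  by rewrite indicE memNset ?mulr0//= => /esym/eqP; exact/negP.
apply: measurable_sum => a; apply: measurable_funM.
  exact: (measurableT_comp IH (@measurable_drop_last A a0)).
apply: measurable_funM; last by apply: measurable_indic; exact: measurable_coord.
exact: (measurableT_comp (measurable_tilt_step t a) (@measurable_drop_last A a0)).
Qed.

Lemma tiltE t om :
  tilt t (past X t%:Z om) =
  expR (lam * (\sum_(i < t) (e i (past X i%:Z om))%:R *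
          (trans_set (past X i%:Z om) - (X i%:Z om \in S)%:R))
        - lam ^+ 2 / 2 * \sum_(i < t) (e i (past X i%:Z om))%:R).
Proof.
elim: t => [|t IH]; first by rewrite !big_ord0 !mulr0 subr0 expR0.
have -> : t.+1%:Z = t%:Z + 1 by lia.
rewrite [LHS]/= drop_last_past past_coord0 IH !big_ord_recr /= /tilt_step.
by case: (e t _); rewrite ?mul0r ?addr0 ?mulr1// -expRD; congr expR; rewrite /=; field.
Qed.

Hypothesis lam1 : `|lam| <= 1.

(** A selected step depends on [a] only through membership in [S], so its mean is the exponential
    moment of a Bernoulli variable of parameter [trans_set x]. *)
Lemma mean_tilt_step t x : \sum_a p x a * tilt_step t a x <= 1.
Proof.
have [p0 p1 _ _] := trX; rewrite /tilt_step.
case: (e t x); last by under eq_bigr do rewrite mulr1; rewrite p1.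
have E : \sum_(a | a \notin S) p x a = 1 - trans_set x.
  by rewrite -(p1 x) [in RHS](bigID (mem S))/= /trans_set addrAC subrr add0r.
have Q := bernoulli_exp_moment (trans_set_itv x) lam1; apply: le_trans Q.
rewrite -E !mulr_suml (bigID (mem S))/=.
rewrite (eq_bigr (fun a => p x a *
    expR (lam * (trans_set x - 1) - lam ^+ 2 / 2))); last first.
  by move=> a ->.
rewrite lerD2l [leLHS](eq_bigr (fun a => p x a *
    expR (lam * trans_set x - lam ^+ 2 / 2)))//.
by move=> a /negbTE ->; rewrite subr0.
Qed.

Lemma integral_tilt t : (\int[P]_om (tilt t (past X t%:Z om))%:E <= 1)%E.
Proof.
elim: t => [|t]; first by rewrite /= integral_cst// mul1e; exact: probability_le1.
(* By the induction hypothesis it suffices that the mean does not increase from [t] to [t + 1]: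
   conditioning on the past of [t] replaces the last factor by its mean, at most 1. *)
apply: le_trans.
have -> : (\int[P]_om (tilt t.+1 (past X t.+1%:Z om))%:E =
    \int[P]_om (tilt t (past X t%:Z om) *
                tilt_step t (X t%:Z om) (past X t%:Z om))%:E)%E.
  apply: eq_integral => om _; have -> : t.+1%:Z = t%:Z + 1 by lia.
  by rewrite /= drop_last_past past_coord0.
rewrite (integral_one_step mX stX trX t%:Z (F := fun a x => tilt t x * tilt_step t a x)).
- have mt : measurable_fun [set: Omega] (fun om => tilt t (past X t%:Z om)).
    exact: (measurableT_comp (measurable_tilt t) (@measurable_past _ _ _ X a0 mX _)).
  apply: ge0_le_integral => //.
  + move=> om _; rewrite lee_fin sumr_ge0// => a _.
    by rewrite mulr_ge0//; [have [] := trX|rewrite mulr_ge0 ?tilt_ge0 ?tilt_step_ge0].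
  + apply/measurable_EFinP/measurable_sum => a; apply: measurable_funM.
      exact: (measurableT_comp (measurable_transition trX a)
        (@measurable_past _ _ _ X a0 mX _)).
    apply: measurable_funM => //.
    exact: (measurableT_comp (measurable_tilt_step t a)
      (@measurable_past _ _ _ X a0 mX _)).
  + exact/measurable_EFinP.
  + move=> om _; rewrite lee_fin.
    under eq_bigr do rewrite mulrCA.
    by rewrite -mulr_sumr ler_piMr ?tilt_ge0// mean_tilt_step.
- by move=> a; apply: measurable_funM;
    [exact: measurable_tilt|exact: measurable_tilt_step].
- by move=> a x; rewrite mulr_ge0 ?tilt_ge0 ?tilt_step_ge0.
Qed.

End exponential_supermartingale.

(** * Peeling over the number of occurrences *)

Section peeling.
Variable R : realType.
Implicit Types (eps M : R) (k N : nat).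

(** This is the logarithmic term of [conf_c] with [ln N] lowered to [k], and also the exponent at
    which one weighted component of the mixture reaches [1 / eps]. *)
Definition peel_level eps k : R := ln (eps^-1) + 2 * ln (2 + 2 * k%:R).
Definition peel_rate eps k : R :=
  Num.min 1 (Num.sqrt (peel_level eps k / 4 ^+ k)).
Definition peel_weight k : R := ((2 + 2 * k%:R) ^+ 2)^-1.

Lemma peel_level_gt0 eps k : 0 < eps < 1 -> 0 < peel_level eps k.
Proof.
move=> /andP[e0 e1]; rewrite ltr_pwDl ?ln_gt0 ?invf_gt1//.
by rewrite mulr_ge0// ln_ge0//; have := ler0n R k; lra.
Qed.

Lemma peel_rate_itv eps k : 0 <= peel_rate eps k <= 1.
Proof. by rewrite le_min ler01 sqrtr_ge0 ge_min lexx. Qed.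

Lemma expR_peel_level eps k : 0 < eps ->
  peel_weight k * expR (peel_level eps k) = eps^-1.
Proof.
move=> e0; have k0 : 0 < 2 + 2 * k%:R :> R by have := ler0n R k; lra.
rewrite /peel_level expRD lnK ?posrE ?invr_gt0//.
rewrite (expRM_natl 2) lnK ?posrE//.
by rewrite mulrCA mulVf ?mulr1// expf_neq0// gt_eqF.
Qed.

Lemma sum_peel_weight n : 2 * \sum_(k < n) peel_weight k <= 1.
Proof.
(* The slack [1 / (2 n)] makes the bound inductive by telescoping; for [n = 0] the inverse of zero
   is 0 and the claim reads [0 <= 1]. *)
suff : 2 * \sum_(k < n) peel_weight k <= 1 - (2 * n%:R)^-1.
  by move/le_trans; apply; rewrite lerBlDr lerDl invr_ge0 mulr_ge0.
elim: n => [|n IH]; first by rewrite big_ord0 mulr0 invr0 subr0.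
rewrite big_ord_recr/= mulrDr.
have [->|n0] := posnP n.
  by rewrite big_ord0 /peel_weight !mulr0 addr0 add0r mulr1; lra.
apply: le_trans (lerD IH (lexx _)) _; rewrite /peel_weight.
have n1 : 0 < n%:R :> R by rewrite ltr0n.
rewrite -subr_ge0 -natr1 [X in 0 <= X](_ : _ =
    (2 * n%:R * (n%:R + 1) ^+ 2)^-1); last first.
  by field; rewrite ?gt_eqF//; lra.
by rewrite invr_ge0 mulr_ge0 ?sqr_ge0// mulr_ge0// ltW.
Qed.

Lemma natr_le_ln k N : (4 ^ k <= N)%N -> k%:R <= ln (N%:R : R).
Proof.
move=> kN; apply: (@le_trans _ _ (ln ((4 ^ k)%:R))); last first.
  by rewrite ler_ln ?posrE ?ltr0n ?expn_gt0 ?ler_nat//;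
    apply: leq_trans kN; rewrite expn_gt0.
rewrite natrX lnXn// -[leRHS]mulr_natl ler_peMr//.
(* What remains is [ln 4 >= 1], which follows from [ln (1/2) <= -1/2]. *)
have -> : (4 : R) = (2^-1 * 2^-1)^-1 by field.
rewrite lnV ?posrE// lnM ?posrE//.
have := @le_ln1Dx R (- 2^-1); rewrite (_ : 1 + - 2^-1 = 2^-1); last by field.
by move=> /(_ _); lra.
Qed.

Lemma peeling_deviation n N M eps : 0 < eps < 1 -> (0 < N <= n)%N ->
  `|M| <= N%:R -> Num.min (conf_c N eps) 1 * N%:R < `|M| ->
  exists k : 'I_n, let lam := peel_rate eps k in
    eps^-1 <= peel_weight k *
    (expR (lam * M - lam ^+ 2 / 2 * N%:R) +
     expR (- lam * M - (- lam) ^+ 2 / 2 * N%:R)).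
Proof.
move=> eps01 /andP[N0 Nn] MN dev; have /andP[e0 e1] := eps01.
have Nr0 : 0 < N%:R :> R by rewrite ltr0n.
(* Since [|M| <= N], a strict violation is impossible with a radius of at least 1. *)
have c1 : conf_c N eps < 1.
  rewrite ltNge; apply/negP => c1; move: dev.
  by rewrite min_r// mul1r ltNge MN.
move: dev; rewrite min_l ?ltW// => dev.
have /andP[] := trunc_log_bounds (isT : 1 < 4)%N N0.
set k := trunc_log 4 N => kN Nk.
have kn : (k < n)%N.
  by apply: leq_trans Nn; apply: leq_trans kN; exact: ltn_expl.
exists (Ordinal kn) => lam; set b := peel_level eps k.
set K : R := 4 ^+ k; have K0 : 0 < K by rewrite exprn_gt0.
have KN : K <= N%:R by rewrite /K -natrX ler_nat.
have NK : N%:R < 4 * K by rewrite /K -exprS -natrX ltr_nat.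
have b0 : 0 < b by exact: peel_level_gt0.
set B := ln (eps^-1) + 2 * ln (2 + 2 * ln N%:R).
have bB : b <= B.
  rewrite lerD2l ler_pM2l// ler_ln ?posrE.
  - by rewrite lerD2l ler_pM2l// natr_le_ln.
  - by have := ler0n R k; lra.
  - by have := natr_le_ln kN; have := ler0n R k; lra.
have confE : conf_c N eps ^+ 2 = 4 * B / N%:R.
  rewrite /conf_c -/B !exprMn !sqr_sqrtr ?invr_ge0 ?ler0n//.
    by field; rewrite gt_eqF.
  by apply: le_trans bB; exact: ltW.
have conf0 : 0 <= conf_c N eps by rewrite /conf_c !mulr_ge0 ?sqrtr_ge0.
(* With [N < 4 K] this gives [b <= B < K], so the cap at 1 in [peel_rate] is inactive. *)
have BN : 4 * B < N%:R.
  by rewrite -[ltRHS]mul1r -ltr_pdivrMr// -confE expr_lt1.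
have lam2 : lam = Num.sqrt (b / K).
  rewrite /lam /peel_rate -/b -/K min_r// -[leRHS]sqrtr1 ler_sqrt// ler_pdivrMr// mul1r.
  lra.
have lam0 : 0 <= lam by rewrite lam2 sqrtr_ge0.
have lamsq : lam ^+ 2 = b / K by rewrite lam2 sqr_sqrtr// divr_ge0 ?ltW.
set s := Num.sqrt (N%:R / K).
have ssq : s ^+ 2 = N%:R / K by rewrite sqr_sqrtr// divr_ge0 ?ltW.
have s0 : 0 <= s by rewrite sqrtr_ge0.
have s1 : 1 <= s.
  by rewrite -(@ler_pXn2r _ 2)// ?nnegrE// ssq expr1n ler_pdivlMr// mul1r.
have s2 : s <= 2.
  rewrite -(@ler_pXn2r _ 2)// ?nnegrE// ssq ler_pdivrMr//; lra.
(* With s = sqrt (N / 4^k) in [1, 2], lam |M| - lam^2 N / 2 >= b (2 s - s^2 / 2),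
   which is at least b. *)
have lamM : 2 * b * s <= lam * `|M|.
  rewrite -(@ler_pXn2r _ 2)// ?nnegrE ?mulr_ge0 ?(ltW b0)//.
  rewrite !exprMn ssq lamsq -mulrA.
  have M2 : 4 * b * N%:R <= `|M| ^+ 2.
    apply: (@le_trans _ _ ((conf_c N eps * N%:R) ^+ 2)); last first.
      by rewrite lerXn2r ?nnegrE ?mulr_ge0 ?ler0n// ltW.
    rewrite exprMn confE [leRHS](_ : _ = 4 * B * N%:R); last by field; rewrite gt_eqF.
    by rewrite ler_pM2r// ler_pM2l.
  apply: (@le_trans _ _ (b / K * (4 * b * N%:R))).
    by rewrite le_eqVlt; apply/orP; left; apply/eqP; field; rewrite gt_eqF.
  by rewrite ler_pM2l// divr_gt0.
have exponent : b <= lam * `|M| - lam ^+ 2 / 2 * N%:R.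
  have -> : lam ^+ 2 / 2 * N%:R = b * (s ^+ 2 / 2).
    by rewrite ssq lamsq; field; rewrite gt_eqF.
  have : 1 <= 2 * s - s ^+ 2 / 2 by nra.
  by move=> /(ler_wpM2l (ltW b0)); nra.
rewrite -(expR_peel_level k e0) -/b ler_pM2l; last first.
  by rewrite invr_gt0 exprn_gt0//; have := ler0n R k; lra.
apply: (@le_trans _ _ (expR (lam * `|M| - lam ^+ 2 / 2 * N%:R))).
  by rewrite ler_expR.
(* The rate with the sign of [M] yields the exponential with [lam |M|]; the other exponential is
   nonnegative. *)
have [M0|M0] := leP 0 M.
  by rewrite ger0_norm// lerDl expR_ge0.
by rewrite ltr0_norm// sqrrN mulNr -mulrN lerDr expR_ge0.
Qed.

End peeling.

(** * The mixture of exponentials and Markov's inequality *)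

Section mixture.
Context (A : finType) d (Omega : measurableType d) (R : realType).
Variables (P : probability Omega R) (X : int -> Omega -> A) (a0 : A).
Variable p : (nat -> A) -> A -> R.
Hypothesis mX : forall t a, measurable (X t @^-1` [set a]).
Hypothesis stX : is_stationary P X.
Hypothesis trX : is_transition_prob P X p.
Local Notation T := (@past_space A a0).
Variables (e : nat -> T -> bool) (S : {set A}) (eps : R).
Hypothesis me : forall t, measurable_fun [set: T] (e t).

(** Levels below [n] suffice because [k < 4 ^ k <= N <= n]; the two signs treat deviations on either
    side. *)
Definition tilt_mixture (n t : nat) (x : T) : R :=
  \sum_(k < n) peel_weight R k * (tilt p e S (peel_rate eps k) t x +
                                  tilt p e S (- peel_rate eps k) t x).

Lemma peel_weight_ge0 k : 0 <= peel_weight R k.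
Proof. by rewrite invr_ge0 sqr_ge0. Qed.

Lemma tilt_mixture_ge0 n t x : 0 <= tilt_mixture n t x.
Proof.
by rewrite sumr_ge0// => k _; rewrite mulr_ge0 ?peel_weight_ge0 ?addr_ge0 ?tilt_ge0.
Qed.

Lemma measurable_tilt_mixture n t : measurable_fun [set: T] (tilt_mixture n t).
Proof.
apply: measurable_sum => k; apply: measurable_funM => //.
by apply: measurable_funD; exact: (measurable_tilt trX).
Qed.

Lemma integral_tilt_mixture n t :
  (\int[P]_om (tilt_mixture n t (past X t%:Z om))%:E <= 1)%E.
Proof.
have mt lam : measurable_fun [set: Omega]
    (fun om => (tilt p e S lam t (past X t%:Z om))%:E).
  apply/measurable_EFinP.
  exact: (measurableT_comp (measurable_tilt trX S lam me t)
    (@measurable_past _ _ _ X a0 mX _)).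
have t0 lam om : (0 <= (tilt p e S lam t (past X t%:Z om))%:E)%E.
  by rewrite lee_fin tilt_ge0.
under eq_integral do rewrite /tilt_mixture -sumEFin.
rewrite ge0_integral_sum//; last 2 first.
- move=> k; under eq_fun do rewrite EFinM EFinD.
  by apply: measurable_funeM; exact: emeasurable_funD.
- by move=> k om _; rewrite lee_fin mulr_ge0 ?peel_weight_ge0 ?addr_ge0 ?tilt_ge0.
apply: (@le_trans _ _ (\sum_(k < n) (2 * peel_weight R k)%:E)%E); last first.
  by rewrite sumEFin lee_fin -mulr_sumr sum_peel_weight.
apply: lee_sum => k _.
under eq_integral do rewrite EFinM EFinD.
rewrite ge0_integralZl//; last 3 first.
- exact: emeasurable_funD.
- by move=> om _; rewrite adde_ge0.
- by rewrite lee_fin peel_weight_ge0.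
rewrite ge0_integralD// mulrC EFinM lee_wpmul2l ?lee_fin ?peel_weight_ge0//.
have /andP[r0 r1] := peel_rate_itv eps k.
rewrite (_ : 2%:E = 1 + 1)%E; last by rewrite -EFinD; congr EFin; lra.
by apply: leeD; apply: integral_tilt => //; rewrite ?normrN ger0_norm.
Qed.

Lemma markov_tilt_mixture n t : 0 < eps ->
  (P [set om | eps^-1 <= tilt_mixture n t (past X t%:Z om)]%R <= eps%:E)%E.
Proof.
move=> e0; have ei : 0 < eps^-1 by rewrite invr_gt0.
have mZ : measurable_fun [set: Omega] (fun om => tilt_mixture n t (past X t%:Z om)).
  exact: (measurableT_comp (measurable_tilt_mixture n t)
    (@measurable_past _ _ _ X a0 mX _)).
have := @le_integral_comp_abse _ _ _ P setT measurableT
  (fun om => (tilt_mixture n t (past X t%:Z om))%:E) eps^-1 id.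
rewrite setTI => /(_ (@measurable_id _ _ _) (fun _ => id) (fun _ _ _ _ => id) _ ei).
rewrite measurable_EFinP => /(_ mZ); under eq_fun do rewrite /=.
have -> : [set om | ((eps^-1)%:E <= `|(tilt_mixture n t (past X t%:Z om))%:E|)%E] =
    [set om | eps^-1 <= tilt_mixture n t (past X t%:Z om)].
  by apply/seteqP; split=> om /=; rewrite lee_fin ger0_norm ?tilt_mixture_ge0.
under eq_integral do rewrite gee0_abs ?lee_fin ?tilt_mixture_ge0//.
move=> /le_trans /(_ (integral_tilt_mixture n t)).
by rewrite muleC -lee_pdivlMr// invrK mul1e.
Qed.

End mixture.

(** * Words and their occurrences *)

(* The symbol at time t - k is x (k - 1): this says that t - 1 >= j and that the
   length-m words ending at times t - 1 and j agree. *)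
Definition word_match (A : finType) (a0 : A) (j m t : nat) (x : past_space a0) : bool :=
  (j < t)%N && (mkseq x m == mkseq (fun k => x (t.-1 - j + k)%N) m).

Lemma measurable_word_match (A : finType) (a0 : A) j m t :
  measurable_fun [set: past_space a0] (@word_match A a0 j m t).
Proof.
apply: (@measurable_fun_bool _ _ _ _ true); rewrite setTI.
case: (ltnP j t) => jt; last first.
  rewrite (_ : _ @^-1` _ = set0)//; apply/seteqP; split => // x /=.
  by rewrite /word_match ltnNge jt.
(* Equality of two coordinates is a finite union over their common value [a]. *)
rewrite (_ : _ @^-1` _ = \bigcap_(k < m) \bigcup_(a in [set: A])
    ([set x : past_space a0 | x k = a] `&`
     [set x : past_space a0 | x (t.-1 - j + k)%N = a])); last first.
  apply/seteqP; split => x /=; rewrite /word_match jt /=.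
    move=> /eqP E k /= km; exists (x k) => //; split => //=.
    by have := congr1 (nth a0 ^~ k) E; rewrite !nth_mkseq.
  move=> E; apply/eqP/(@eq_from_nth _ a0); rewrite ?size_mkseq// => k km.
  by rewrite !nth_mkseq//; have [a _ [/= -> ->]] := E k km.
apply: bigcap_measurableType => k _; apply: fin_bigcup_measurable => // a _.
by apply: measurableI; exact: measurable_coord.
Qed.

Section empirical.
Context (A : finType) d (Omega : measurableType d) (R : realType).
Variables (X : int -> Omega -> A) (p : (nat -> A) -> A -> R) (a0 : A).
Implicit Types (w : seq A) (om : Omega) (S : {set A}).

Lemma occurs_atE w i om : occurs_at X w i om =
  (size w <= i)%N && (mkseq (past X i.+1%:Z om) (size w) == rev w).
Proof.
rewrite /occurs_at (mkseq_past X a0) (inj_eq (can_inj (@revK A))).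
by have -> : i%:Z - (size w)%:Z + 1 = i.+1%:Z - (size w)%:Z by lia.
Qed.

Lemma occurs_at_rcons w a i om :
  occurs_at X (rcons w a) i.+1 om = occurs_at X w i om && (X i.+1%:Z om == a).
Proof.
rewrite /occurs_at size_rcons ltnS -andbA; congr (_ && _).
rewrite /block -[(size w).+1]addn1 iotaD map_cat/= cats1 eqseq_rcons add0n.
have -> : i.+1%:Z - (size w + 1)%N%:Z + 1 = i%:Z - (size w)%:Z + 1 by lia.
by have -> : i%:Z - (size w)%:Z + 1 + (size w)%:Z = i.+1%:Z by lia.
Qed.

Lemma past_add t k om u : past X t om (k + u)%N = past X (t - k%:Z) om u.
Proof. by rewrite /past; congr (X _ om); lia. Qed.

(** If [w] first ends at [j], agreeing with the word that ends at [j] means being an occurrence of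
    [w], and minimality of [j] gives every occurrence the bound [j < t]. An occurrence ending at
    [t - 1] is seen from the past of [t]. *)
Lemma word_match_past w j om : occurs_at X w j om ->
  (forall i, occurs_at X w i om -> (j <= i)%N) ->
  forall t, word_match (a0 := a0) j (size w) t (past X t%:Z om) =
            (0 < t)%N && occurs_at X w t.-1 om.
Proof.
move=> wj jmin [|t]; first by rewrite /word_match ltn0.
rewrite /word_match ltnS /=; case: leqP => [jt|tj]; last first.
  by apply/esym/negbTE/negP => /jmin; rewrite leqNgt tj.
move: wj; rewrite !occurs_atE => /andP[wj /eqP <-].
rewrite (leq_trans wj jt)/=; congr (_ == _).
apply: eq_map => k; rewrite past_add; congr (past X _ om k); lia.
Qed.

Section word.
Variables (w : seq A) (n j : nat) (om : Omega).
Hypothesis n0 : (0 < n)%N.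
Hypothesis wj : occurs_at X w j om.
Hypothesis jmin : forall i, occurs_at X w i om -> (j <= i)%N.
Let wm t := word_match (a0 := a0) j (size w) t (past X t%:Z om).

Let wm0 : wm 0 = false. Proof. by []. Qed.
Let wmS i : wm i.+1 = occurs_at X w i om.
Proof. by rewrite /wm word_match_past. Qed.

Lemma Ncount_word_match :
  (Ncount X n.-1 w om)%:R = \sum_(i < n.+1) (wm i)%:R :> R.
Proof.
rewrite big_ord_recl wm0 add0r /Ncount prednK// big_mkord natr_sum big_mkcond.
apply: eq_bigr => i _; rewrite lift0 wmS.
by case: occurs_at.
Qed.

(** The right side is the martingale [M]: [p_bar] provides the compensator, and the occurrences of
    [wa] with [a] in [S] are those of [w] followed by a symbol of [S]. *)
Lemma empirical_deviation S : (0 < Ncount X n.-1 w om)%N ->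
  (Ncount X n.-1 w om)%:R * (p_bar X p n S w om - p_hat R X n S w om) =
  \sum_(i < n.+1) (wm i)%:R *
     (trans_set p S (past X i%:Z om) - (X i%:Z om \in S)%:R).
Proof.
move=> N0; have Nn : (Ncount X n.-1 w om)%:R != 0 :> R by rewrite pnatr_eq0 -lt0n.
rewrite mulrBr /p_bar mulrA mulfV// mul1r /p_hat [_ * (_ / _)]mulrC divfK//.
(* An occurrence ending at [i] forces [size w <= i], so the lower summation limit in [p_bar] can be
   moved to 0. *)
have occ_size i : occurs_at X w i om && (size w <= i)%N = occurs_at X w i om.
  by rewrite /occurs_at andbAC andbb.
rewrite big_add1/= (big_nat_widenl _ 0)// (eq_bigl _ _ occ_size).
have -> : \sum_(a in S) (Ncount X n (rcons w a) om)%:R =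
    \sum_(0 <= i < n | occurs_at X w i om) (X i.+1%:Z om \in S)%:R :> R.
  rewrite [RHS](eq_bigr (fun i => \sum_(a in S) (X i.+1%:Z om == a)%:R)); last first.
    move=> i _; case: (boolP (_ \in S)) => XS.
      rewrite (bigD1 (X i.+1%:Z om))//= eqxx big1 ?addr0// => a /andP[_].
      by rewrite eq_sym => /negbTE ->.
    rewrite big1// => a aS; case: eqP => // Xa; by rewrite Xa aS in XS.
  rewrite exchange_big/=; apply: eq_bigr => a aS.
  (* A nonempty word cannot end at position 0, so the count of [wa] starts at 1, one step after that
     of [w]. *)
  have occ0 : occurs_at X (rcons w a) 0 om = false by rewrite /occurs_at size_rcons.
  rewrite /Ncount big_mkcond big_ltn// occ0 /= add0n big_add1/= natr_sum [RHS]big_mkcond.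
  apply: eq_bigr => i _; rewrite occurs_at_rcons.
  by case: occurs_at; case: eqP.
rewrite -sumrB big_mkcond big_mkord [RHS]big_ord_recl wm0 mul0r add0r.
apply: eq_bigr => i _; rewrite lift0 wmS.
by case: occurs_at; rewrite ?mul1r ?mul0r.
Qed.

End word.
End empirical.

(** * From a violated radius to a large mixture *)

Section violation.
Context (A : finType) d (Omega : measurableType d) (R : realType).
Variables (P : probability Omega R) (X : int -> Omega -> A) (a0 : A).
Variable p : (nat -> A) -> A -> R.
Hypothesis trX : is_transition_prob P X p.

(** The witnesses are the end [j] of the first occurrence and the length of [w]; both are below [n]
    because [w] occurs in the first [n - 1] symbols. *)
Lemma violation_tilt_mixture (w : seq A) n om S eps :
  0 < eps < 1 -> (0 < n)%N -> (0 < Ncount X n.-1 w om)%N ->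
  Num.min (conf_c (Ncount X n.-1 w om) eps) 1 <
    `|p_bar X p n S w om - p_hat R X n S w om| ->
  exists j m : 'I_n, eps^-1 <=
    tilt_mixture p (@word_match A a0 j m) S eps n n.+1 (past X n.+1%:Z om).
Proof.
move=> eps01 n0 N0 viol.
have Nr0 : 0 < (Ncount X n.-1 w om)%:R :> R by rewrite ltr0n.
have ex : exists i, (i < n)%N && occurs_at X w i om.
  apply: contrapT => /forallNP noocc; move: N0.
  rewrite /Ncount prednK// big_nat_cond big_pred0// => i.
  by rewrite leq0n /=; apply/negP; exact: noocc.
case: (ex_minnP ex) => j /andP[jn wj] jmin'.
have jmin i : occurs_at X w i om -> (j <= i)%N.
  move=> wi; case: (ltnP i n) => [iN|]; last exact: leq_trans (ltnW jn).
  by apply: jmin'; rewrite iN.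
have mn : (size w < n)%N by move: wj => /andP[wj _]; exact: leq_ltn_trans jn.
exists (Ordinal jn), (Ordinal mn).
set e := word_match (a0 := a0) j (size w).
set N := Ncount X n.-1 w om in N0 Nr0 viol.
have NE : N%:R = \sum_(i < n.+1) (e i (past X i%:Z om))%:R :> R.
  exact: (Ncount_word_match R a0 n0 wj jmin).
have ME := empirical_deviation p a0 wj jmin S N0.
set M := \sum_(i < n.+1) (e i (past X i%:Z om))%:R *
     (trans_set p S (past X i%:Z om) - (X i%:Z om \in S)%:R).
have MN : `|M| <= N%:R.
  rewrite NE; apply: le_trans (ler_norm_sum _ _ _) _; apply: ler_sum => i _.
  rewrite normrM normr_nat ler_piMr// ler_norml.
  have /andP[] := trans_set_itv trX S (past X i%:Z om).
  by case: (_ \in S) => /= *; apply/andP; split; lra.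
have Nn : (0 < N <= n)%N.
  rewrite N0/= -(ler_nat R) NE big_ord_recl/= add0r.
  apply: (@le_trans _ _ (\sum_(i < n) 1)); last by rewrite sumr_const card_ord.
  by apply: ler_sum => i _; rewrite lern1; case: (e _ _).
have dev : Num.min (conf_c N eps) 1 * N%:R < `|M|.
  by rewrite /M -ME normrM normr_nat mulrC ltr_pM2l.
have [k kP] := peeling_deviation eps01 Nn MN dev.
apply: le_trans kP _.
(* At time [n + 1] the tilts sum over all [i <= n], which is exactly [M] and [N]; the levels other
   than [k] contribute nonnegative terms. *)
rewrite -[leRHS]/(tilt_mixture p e S eps n n.+1 (past X n.+1%:Z om)).
rewrite /tilt_mixture (bigD1 k)//.
rewrite !tiltE -NE -/M [leRHS]/= lerDl; apply: sumr_ge0 => i _.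
apply: mulr_ge0; first exact: peel_weight_ge0.
by apply: addr_ge0; exact: (@tilt_ge0 _ _ _ _ _ _ _ n.+1).
Qed.

End violation.

(** * Measurability of the good event *)

Section measurability.
Context d (Omega : measurableType d) (R : realType).

Lemma measurable_bigmax (I : Type) (r : seq I) (Q : pred I) (x : R)
    (F : I -> Omega -> R) :
  (forall i, measurable_fun [set: Omega] (F i)) ->
  measurable_fun [set: Omega] (fun om => \big[Num.max/x]_(i <- r | Q i) F i om).
Proof.
move=> mF; elim: r => [|i r IH]; first
  by under eq_fun do rewrite big_nil; exact: measurable_cst.
under eq_fun do rewrite big_cons; case: (Q i) => //.
exact: measurable_maxr.
Qed.

Lemma measurable_le_cst (f : Omega -> R) (c : R) :
  measurable_fun [set: Omega] f -> measurable [set om | f om <= c].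
Proof.
move=> mf; rewrite (_ : [set _ | _] = f @^-1` `]-oo, c]%classic).
  by rewrite -[X in measurable X]setTI; exact: mf.
by apply/seteqP; split => om /=; rewrite in_itv.
Qed.

Lemma measurable_ge_cst (f : Omega -> R) (c : R) :
  measurable_fun [set: Omega] f -> measurable [set om | c <= f om].
Proof.
move=> mf; rewrite (_ : [set _ | _] = f @^-1` `[c, +oo[%classic).
  by rewrite -[X in measurable X]setTI; exact: mf.
by apply/seteqP; split => om /=; rewrite in_itv/= andbT.
Qed.

Lemma measurable_forall_count (I : countType) (F : I -> set Omega) :
  (forall i, measurable (F i)) -> measurable [set om | forall i, F i om].
Proof.
move=> mF; rewrite (_ : [set _ | _] =
    \bigcap_k (if unpickle k is Some i then F i else setT)).
  by apply: bigcapT_measurable => k; case: unpickle.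
apply/seteqP; split => om /= H.
  by move=> k _; case: unpickle.
by move=> i; have := H (pickle i) Logic.I; rewrite pickleK.
Qed.

Context (A : finType).
Variables (X : int -> Omega -> A) (p : (nat -> A) -> A -> R) (a0 : A).
Hypothesis mX : forall t a, measurable (X t @^-1` [set a]).
Hypothesis mp : forall a, measurable_fun [set: past_space a0] (p^~ a).

Lemma measurable_occurs_at w i : measurable_fun [set: Omega] (occurs_at X w i).
Proof.
apply: (@measurable_fun_bool _ _ _ _ true); rewrite setTI.
have [wi|iw] := leqP (size w) i; last first.
  rewrite (_ : _ @^-1` _ = set0)//; apply/seteqP; split => // om /=.
  by rewrite /occurs_at leqNgt iw.
rewrite (_ : _ @^-1` _ = past X i.+1%:Z @^-1` @cylinder A a0 (rev w)).
  rewrite -[X in measurable X]setTI.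
  by apply: (measurable_past mX _ measurableT); exact: measurable_cylinder.
apply/seteqP; split => om /=; rewrite (occurs_atE X a0) wi /cylinder/= size_rev.
  by move/eqP.
by move=> ->; rewrite eqxx.
Qed.

(** Every function on [nat] is measurable, so an arbitrary [f] covers counts, their inverses and the
    radii at once. *)
Lemma measurable_Ncount n w (f : nat -> R) :
  measurable_fun [set: Omega] (fun om => f (Ncount X n w om)).
Proof.
apply: (@measurableT_comp _ _ _ _ _ _ f) => //.
rewrite /Ncount; elim: (index_iota _ _) => [|i r IH].
  by under eq_fun do rewrite big_nil; exact: measurable_cst.
under eq_fun do rewrite big_cons.
apply: measurable_fun_ifT => //; first exact: measurable_occurs_at.
exact: measurable_fun_addn.
Qed.

Lemma measurable_dist n w fam : measurable_fun [set: Omega]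
  (fun om => dist_fam fam (fun S => p_bar X p n S w om) (fun S => p_hat R X n S w om)).
Proof.
apply: measurable_bigmax => S; apply: measurableT_comp => //.
apply: measurable_funB.
  rewrite /p_bar; apply: measurable_funM.
    exact: (measurable_Ncount _ _ (fun N => N%:R^-1)).
  under eq_fun do rewrite big_mkcond.
  apply: measurable_sum => i; apply: measurable_fun_ifT => //.
    exact: measurable_occurs_at.
  under eq_fun do rewrite big_mkcond.
  apply: measurable_sum => a; case: (a \in S) => //.
  exact: (measurableT_comp (mp a) (@measurable_past _ _ _ X a0 mX _)).
rewrite /p_hat; apply: measurable_funM.
  under eq_fun do rewrite big_mkcond.
  apply: measurable_sum => a; case: (a \in S) => //.
  exact: (measurable_Ncount _ _ (fun N => N%:R)).
exact: (measurable_Ncount _ _ (fun N => N%:R^-1)).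
Qed.

End measurability.

(** * Union bound and conclusion *)

Lemma finite_union_bound d (Omega : measurableType d) (R : realType)
    (P : probability Omega R) (I : finType) (D : {set I}) (B : I -> set Omega) (eps : R) :
  (forall i, measurable (B i)) -> (forall i, i \in D -> (P (B i) <= eps%:E)%E) ->
  measurable (\big[setU/set0]_(i in D) B i) /\
  (P (\big[setU/set0]_(i in D) B i) <= (#|D|%:R * eps)%:E)%E.
Proof.
move=> mB PB; rewrite mulr_natl -sumr_const -sumEFin.
apply: (big_rec2 (fun (U : set Omega) (x : \bar R) => measurable U /\ (P U <= x)%E)).
  by split; rewrite ?measure0.
move=> i x U iD [mU PU]; split; first exact: measurableU.
apply: le_trans (leeD (PB i iD) PU).
exact: measureU2.
Qed.

Theorem theorem4p1 (R : realType) (d : measure_display) (Omega : measurableType d)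
  (P : probability Omega R) (A : finType) (L : nat)
  (X : 'I_L -> int -> Omega -> A)
  (p : 'I_L -> (nat -> A) -> A -> R)
  (fam : {set {set A}}) (n : nat) (delta : R) :
  (forall l t a, measurable (X l t @^-1` [set a])) ->
  (forall l, is_stationary P (X l)) ->
  (forall l, is_ergodic P (X l)) ->
  (forall l, is_transition_prob P (X l) (p l)) ->
  (fam = ([set [set a] | a : A])%SET \/ fam = [set: {set A}]%SET) ->
  (0 < n)%N ->
  0 < delta < 1 ->
  let conf l w om :=
    Num.min (conf_c (Ncount (X l) n.-1 w om)
                     (delta / ((n ^ 2)%:R * (#|fam|)%:R * L%:R))) 1 in
  let Good om :=
    forall w : seq A, (forall l, (0 < Ncount (X l) n.-1 w om)%N) ->
      \big[Num.max/0]_(l < L)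
         (dist_fam fam (fun S => p_bar (X l) (p l) n S w om)
                       (fun S => p_hat R (X l) n S w om) / conf l w om) <= 1 in
  ((1 - delta)%:E <= P [set om | Good om])%E.
Proof.
move=> mX stX _ trX _ n0 delta01.
pose eps : R := delta / ((n ^ 2)%:R * (#|fam|)%:R * L%:R).
pose conf l w om := Num.min (conf_c (Ncount (X l) n.-1 w om) eps) 1.
pose Good om := forall w : seq A, (forall l, (0 < Ncount (X l) n.-1 w om)%N) ->
  \big[Num.max/0]_(l < L)
     (dist_fam fam (fun S => p_bar (X l) (p l) n S w om)
                   (fun S => p_hat R (X l) n S w om) / conf l w om) <= 1.
rewrite -[is_true _]/(is_true ((1 - delta)%:E <= P [set om | Good om])%E).
(* Without any process the maximum is its default 0 and every sample is good; otherwise a process at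
   the base point supplies the letter [a0]. *)
case: (pselect (exists _ : 'I_L, True)) => [[l0 _]|noL]; last first.
  rewrite (_ : [set om | Good om] = setT); last first.
    apply/seteqP; split => // om _ w _.
    by apply/bigmax_leP; split => // l _; case: noL; exists l.
  by rewrite probability_setT lee_fin; lra.
pose a0 := X l0 0 point.
have mGood : measurable [set om | Good om].
  apply: measurable_forall_count => w.
  rewrite (_ : (fun _ => _) = (~` [set om | forall l, (0 < Ncount (X l) n.-1 w om)%N]) `|`
    [set om | \big[Num.max/0]_(l < L)
         (dist_fam fam (fun S => p_bar (X l) (p l) n S w om)
                       (fun S => p_hat R (X l) n S w om)
            / conf l w om) <= 1]); last first.
    apply/seteqP; split => om /=; last by case.
    move=> H; have [N0|] := pselect (forall l, (0 < Ncount (X l) n.-1 w om)%N).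
      by right; exact: H.
    by left.
  apply: measurableU.
    apply/measurableC/measurable_forall_count => l.
    have := @measurable_Ncount _ _ R _ _ a0 (mX l) n.-1 w (fun N => (N == 0)%:R).
    move=> /(@measurable_le_cst _ _ _ _ 0); congr measurable.
    by apply/seteqP; split => om /=; case: (Ncount _ _ _ _) => //=; rewrite ler10.
  apply: measurable_le_cst; apply: measurable_bigmax => l.
  apply: measurable_funM; first exact: (measurable_dist (mX l)
    (@measurable_transition _ _ _ _ _ _ a0 _ (trX l))).
  exact: (measurable_Ncount a0 (mX l) _ _ (fun N => (Num.min (conf_c N eps) 1)^-1)).
(* One index for each process, set of the family and pair [(j, m)]: their number is the denominator
   of [eps]. *)
pose D := [set i : 'I_L * {set A} * ('I_n * 'I_n) | i.1.2 \in fam]%SET.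
pose B (i : 'I_L * {set A} * ('I_n * 'I_n)) := [set om | eps^-1 <=
  tilt_mixture (p i.1.1) (@word_match A a0 i.2.1 i.2.2) i.1.2 eps n n.+1
    (past (X i.1.1) n.+1%:Z om)].
have cardD : #|D|%:R = (n ^ 2)%:R * #|fam|%:R * L%:R :> R.
  have -> : D = finset.setX (finset.setX [set: 'I_L]%SET fam) [set: 'I_n * 'I_n]%SET.
    by apply/setP => -[[l S] jm]; rewrite !inE/= andbT.
  rewrite !cardsX !cardsT card_prod !card_ord -!natrM.
  by rewrite mulnn mulnC (mulnC L) mulnA.
(* An element of [D] makes this denominator positive; for empty [D] the quotient [eps] is 0 by
   convention. *)
have epsP i : i \in D -> 0 < eps < 1.
  move=> iD; have D0 : 0 < #|D|%:R :> R by rewrite ltr0n; apply/card_gt0P; exists i.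
  rewrite /eps -cardD divr_gt0//=; last by case/andP: delta01.
  rewrite ltr_pdivrMr// mul1r; case/andP: delta01 => _ /lt_le_trans; apply.
  by rewrite ler1n -(ltr0n R).
have mB i : measurable (B i).
  apply: measurable_ge_cst.
  have mZ := measurable_tilt_mixture (trX i.1.1) i.1.2 eps
    (fun t => @measurable_word_match A a0 i.2.1 i.2.2 t) n n.+1.
  exact: (measurableT_comp mZ (@measurable_past _ _ _ (X i.1.1) a0 (mX i.1.1) _)).
have PB i : i \in D -> (P (B i) <= eps%:E)%E.
  move=> /epsP /andP[e0 _].
  apply: (markov_tilt_mixture (mX i.1.1) (stX i.1.1) (trX i.1.1)) => // t.
  exact: measurable_word_match.
have [mU PU] := finite_union_bound mB PB.
set U := \big[setU/set0]_(i in D) B i in mU PU.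
have GU : ~` U `<=` [set om | Good om].
  move=> om nU w N0.
  apply/bigmax_leP; split=> // l _.
  set c := conf l w om; set dd := dist_fam _ _ _.
  (* The radius is nonnegative, so here it vanishes and the quotient is 0 by the convention on
     inverses. *)
  have [c0|c0] := leP c 0.
    suff -> : c = 0 by rewrite invr0 mulr0 ler01.
    apply/eqP; rewrite eq_le c0 le_min ler01 andbT.
    by rewrite /conf_c !mulr_ge0 ?sqrtr_ge0.
  rewrite ler_pdivrMr// mul1r; apply/bigmax_leP; split; first exact: ltW.
  move=> S SF; rewrite leNgt; apply/negP => viol; apply: nU.
  have lSD j m : (l, S, (j, m)) \in D by rewrite inE.
  have e01 : 0 < eps < 1 by apply: (epsP (l, S, (Ordinal n0, Ordinal n0))).
  have [j [m jm]] := violation_tilt_mixture a0 (trX l) e01 n0 (N0 l) viol.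
  rewrite /U (bigD1 (l, S, (j, m)))//=; left; exact: jm.
have PG : (P (~` [set om | Good om]) <= delta%:E)%E.
  apply: (@le_trans _ _ (P U)).
    by apply: le_measure; rewrite ?inE//; [exact: measurableC|exact: subsetCl].
  apply: le_trans PU _; rewrite lee_fin /eps -cardD.
  have [->|D0] := eqVneq (#|D|%:R : R) 0; first by rewrite mul0r; lra.
  by rewrite mulrC divfK.
rewrite -[X in P X]setCK probability_setC; last exact: measurableC.
by rewrite EFinB leeB.
Qed.
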